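(* Let $m\ge 1$ be a fixed integer, let $q=2^\ell$ be a power of two, and let $r$ be an integer with $1\le r<q$. Then the rate of the $[m,q-r,q]$-lifted-RS code is $$1-\Theta\left((q/r)^{\log \lambda_m-m}\right)\quad\text{as } q\to\infty,$$ where the implied constants depend only on $m$ (so $r$ may vary with $q$).
   Context: $\log$ is the logarithm in base two. $\mathbb{F}_q$ is the field with $q$ elements. Lifted Reed-Solomon code. Let $\mathcal{L}_m$ be the set of all lines $(\mathbf{a}T+\mathbf{b})|_{T\in\mathbb{F}_q}$ in $\mathbb{F}_q^m$, with $\mathbf a,\mathbf b\in\mathbb{F}_q^m$. For a positive integer $d<q$ let $\mathcal{F}_{d,q}=\{f(T)\in\mathbb{F}_q[T]:\deg f<d\}$. The restriction $f|_L$ of a polynomial $f\in\mathbb{F}_q[X_1,\dots,X_m]$ to a line $L=(\mathbf aT+\mathbf b)|_{T\in\mathbb{F}_q}$ is the univariate polynomial $f(\mathbf aT+\mathbf b)$ reduced modulo $T^q-T$ (i.e. the function $T\mapsto f(\mathbf aT+\mathbf b)$ on $\mathbb{F}_q$ represented by its unique polynomial of degree at most $q-1$). The $[m,d,q]$-lifted-RS code is the linear code over $\mathbb{F}_q$ of length $q^m$ $$\left\{(f(\mathbf a))_{\mathbf a\in\mathbb{F}_q^m}:\ f\in\mathbb{F}_q[X_1,\dots,X_m],\ f|_L\in\mathcal{F}_{d,q}\text{ for all }L\in\mathcal{L}_m\right\}.$$ The rate of a linear code is its dimension divided by its length. The number $\lambda_m$. Let $A_m$ be the $m\times m$ matrix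 with rows and columns indexed by $0,1,\dots,m-1$ whose entry in row $j$ and column $0$ is $\binom{m}{\ge 2j+1}$ and whose entry in row $j$ and column $c\ge 1$ is $\binom{m}{2j+1-c}$. Here $\binom{b}{\ge a}$ is the number of subsets with at least $a$ elements of a $b$-element set, and $\binom{b}{a}=0$ if $a<0$ or $a>b$. Then $\lambda_m$ is the largest eigenvalue of $A_m$ ($A_m$ is entrywise non-negative, so this is its spectral radius). *)

(* Defs.v *)
From HB Require Import structures.
From mathcomp Require Import all_boot all_order all_algebra all_field.
From mathcomp Require Import mpoly.
From mathcomp Require Import boolp classical_sets reals exp.

Set Implicit Arguments.
Unset Strict Implicit.
Unset Printing Implicit Defensive.

Import Order.TTheory GRing.Theory Num.Theory.
Local Open Scope ring_scope.

Section LiftedRS.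
Variables (F : finFieldType) (m : nat).

Definition line_restr (f : {mpoly F[m]}) (a b : 'rV[F]_m) : {poly F} :=
  mmap (@polyC F) (fun i => (a 0 i)%:P * 'X + (b 0 i)%:P) f
    %% ('X^#|F| - 'X).

(* [size p <= d] is [deg p < d], the zero polynomial included. *)
Definition low_degree_on_lines (d : nat) (f : {mpoly F[m]}) : Prop :=
  forall a b : 'rV[F]_m, (size (line_restr f a b) <= d)%N.

Definition evaluation (f : {mpoly F[m]}) : {ffun 'rV[F]_m -> F^o} :=
  [ffun x : 'rV[F]_m => f.@[fun i => x 0 i]].

Definition lifted_RS_codeword (d : nat) (c : {ffun 'rV[F]_m -> F^o}) : Prop :=
  exists2 f : {mpoly F[m]}, low_degree_on_lines d f & c = evaluation f.

(* The codewords already form a linear subspace, so taking the span adds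
   nothing: see [lifted_RSP]. *)
Definition lifted_RS (d : nat) : {vspace {ffun 'rV[F]_m -> F^o}} :=
  <<enum [pred c : {ffun 'rV[F]_m -> F^o} | `[< lifted_RS_codeword d c >]]>>%VS.

Lemma lifted_RS_codeword0 d : lifted_RS_codeword d 0.
Proof.
exists 0; last by apply/ffunP => x; rewrite !ffunE meval0.
by move=> a b; rewrite /line_restr mmap0 mod0p size_poly0.
Qed.

Lemma lifted_RS_codewordP d k c1 c2 :
  lifted_RS_codeword d c1 -> lifted_RS_codeword d c2 ->
  lifted_RS_codeword d (k *: c1 + c2).
Proof.
move=> [f1 h1 ->] [f2 h2 ->]; exists (k *: f1 + f2); last first.
  by apply/ffunP => x; rewrite !ffunE mevalD mevalZ.
move=> a b; rewrite /line_restr mmapD mmapZ mul_polyC modpD modpZl.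
apply: leq_trans (size_polyD _ _) _; rewrite geq_max h2 andbT.
exact: leq_trans (size_scale_leq _ _) (h1 a b).
Qed.

Lemma lifted_RSP d c : c \in lifted_RS d <-> lifted_RS_codeword d c.
Proof.
split=> [|hc]; last by apply: memv_span; rewrite mem_enum inE.
rewrite /lifted_RS; set s := fintype.enum_mem _ => /(coord_span (X := in_tuple s)) ->.
elim/big_ind: _ => [|x y hx hy|i _]; first exact: lifted_RS_codeword0.
  by rewrite -[x]scale1r; apply: lifted_RS_codewordP.
rewrite -[_ *: _]addr0; apply: lifted_RS_codewordP; last exact: lifted_RS_codeword0.
have : s`_i \in s by rewrite mem_nth.
by rewrite mem_enum inE.
Qed.

End LiftedRS.

Arguments lifted_RS : clear implicits.

Definition rate (R : realType) (F : finFieldType) (I : finType)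
    (C : {vspace {ffun I -> F^o}}) : R :=
  (\dim C)%:R / #|I|%:R.

Arguments rate R {F I} C.

Definition binom_ge (b a : nat) : nat := #|[set S : {set 'I_b} | (a <= #|S|)%N]|.

(* The guard [c <= 2 * j + 1] is needed because subtraction on [nat] is
   truncated, whereas the binomial must vanish at negative arguments. *)
Definition lifting_matrix (R : realType) (m : nat) : 'M[R]_m :=
  \matrix_(j < m, c < m)
    (if (c == 0 :> nat)%N then binom_ge m (2 * j + 1)
     else if (c <= 2 * j + 1)%N then 'C(m, 2 * j + 1 - c) else 0%N)%:R.

(* The set of real eigenvalues is finite, and nonempty for [0 < m] by
   Perron-Frobenius, so this supremum is a maximum. *)
Definition lambda (R : realType) (m : nat) : R :=
  sup [set x : R | eigenvalue (lifting_matrix R m) x]%classic.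

Definition log2 (R : realType) (x : R) : R := ln x / ln 2.

(* Main.v *)
Require Import Defs.
From mathcomp Require Import all_boot all_order all_algebra all_field.
From mathcomp Require Import mpoly.
From mathcomp Require Import boolp classical_sets reals exp topology normedtype derive.
From mathcomp Require Import zify ring lra.

(** The monomials with exponents below [q] form a basis of all functions, and a
    function is a codeword iff only good monomials occur in it; by Lucas, [X^e]
    is bad iff some vector [I], bitwise below [e], has a coordinate sum which
    reduces modulo [T^q - T] to an exponent [>= q - r].  So [1 - rate] is the
    proportion of bad exponent vectors.

    For [2^s <= r < 2^(s+1)] badness amounts, up to a factor depending on [m]
    only, to a condition on the top [n = l - s] bits: adding suitable submasks
    of the columns of bits must produce the digit [1] at each position.  The
    carries that can occur at a position form an interval [0..c], and if the
    next column has weight [w] then [c] becomes [(w + c - 1) / 2], or the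
    process dies if [w + c = 0].  Number of survivors of this process: the
    partial sums of a left Perron eigenvector of the lifting matrix form a
    positive eigenvector of its transition operator, hence [n] steps have
    [Theta(lambda^n)] survivors. *)

Set Implicit Arguments.
Unset Strict Implicit.
Unset Printing Implicit Defensive.
Import Order.TTheory GRing.Theory Num.Theory.

(** * Counting bad exponents *)

(** In Pascal's rule applied twice the middle term occurs twice and cancels modulo 2, as in
    [(1 + X)^2 = 1 + X^2]. *)
Lemma odd_binSS n k : odd 'C(n.+2, k.+2) = odd 'C(n, k) (+) odd 'C(n, k.+2).
Proof. by rewrite !binS !oddD; case: odd; case: odd; case: odd. Qed.

(** Lucas' theorem modulo 2 for the lowest binary digit; [odd_bin_split] iterates it over the [s]
    lowest digits. *)
Lemma odd_binD2 a (x : bool) b (y : bool) :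
  odd 'C(2 * a + x, 2 * b + y) = odd 'C(a, b) && (y <= x).
Proof.
elim: a b x y => [|a IHa] [|b] x y.
- by case: x; case: y.
- by case: x; case: y; rewrite bin_small //; lia.
- by case: x; case: y; rewrite ?muln0 ?addn0 ?bin0 ?bin1 //; lia.
have -> : 2 * a.+1 + x = (2 * a + x).+2 by lia.
have -> : 2 * b.+1 + y = (2 * b + y).+2 by lia.
rewrite odd_binSS IHa.
have -> : (2 * b + y).+2 = 2 * b.+1 + y by lia.
by rewrite IHa binS oddD; case: (y <= x); rewrite ?andbT ?andbF // addbC.
Qed.

Lemma odd_bin_split s a x b y : x < 2 ^ s -> y < 2 ^ s ->
  odd 'C(2 ^ s * a + x, 2 ^ s * b + y) = odd 'C(a, b) && odd 'C(x, y).
Proof.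
elim: s a x b y => [|s IHs] a x b y hx hy.
  have [-> ->] : x = 0 /\ y = 0 by lia.
  by rewrite !mul1n !addn0 bin0 andbT.
rewrite !expnS in hx hy *.
rewrite -[x]odd_double_half -[y]odd_double_half -!muln2.
have e (c z : nat) (t : bool) :
  2 * 2 ^ s * c + (t + z * 2) = 2 * (2 ^ s * c + z) + t by lia.
have e2 (z : nat) (t : bool) : t + z * 2 = 2 * z + t by lia.
rewrite !e !e2 !odd_binD2 IHs ?andbA //; lia.
Qed.

(** * Propagating carries through columns of bits *)

Section Digits.
Variable m : nat.
Implicit Types (D I : {ffun 'I_m -> nat}) (P Q : {ffun 'I_m -> nat} -> bool).

(** The predicate lives on [nat]-valued vectors, so that the same one can be counted in boxes of
    different sizes. *)
Definition box_count (N : nat) P : nat :=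
  \sum_(D : {ffun 'I_m -> 'I_N}) P [ffun j => D j : nat].

Lemma leq_box_count N P Q :
  (forall D, (forall j, D j < N) -> P D -> Q D) ->
  box_count N P <= box_count N Q.
Proof.
move=> h; apply: leq_sum => D _.
case hP: (P _) => //; rewrite h // => j; by rewrite ffunE.
Qed.

(** Division with remainder by [a] in each coordinate. The low part [x] stays outside, so that for
    fixed [x] the inner count concerns the high digits alone. *)
Lemma box_countM a b P :
  box_count (a * b) P =
  \sum_(x : {ffun 'I_m -> 'I_a})
    box_count b (fun D => P [ffun j => a * D j + x j]).
Proof.
have hlt (x : 'I_a) (y : 'I_b) : a * y + x < a * b.
  by have := ltn_ord x; have := ltn_ord y; nia.
have hm (z : 'I_(a * b)) : z %% a < a.
  by rewrite ltn_mod; have := ltn_ord z; nia.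
have hd (z : 'I_(a * b)) : z %/ a < b.
  by have hz := ltn_ord z; rewrite ltn_divLR; [rewrite [b * a]mulnC | nia].
rewrite pair_bigA /= /box_count.
pose h (p : {ffun 'I_m -> 'I_a} * {ffun 'I_m -> 'I_b}) :=
  [ffun j => Ordinal (hlt (p.1 j) (p.2 j))].
rewrite (reindex h) /=.
  apply: eq_bigr => -[x y] _; congr (nat_of_bool (P _)).
  by apply/ffunP => j; rewrite !ffunE.
exists (fun z => ([ffun j => Ordinal (hm (z j))], [ffun j => Ordinal (hd (z j))])).
  move=> [x y] _; congr pair; apply/ffunP => j; rewrite !ffunE; apply: val_inj => /=.
    by rewrite mulnC modnMDl modn_small.
  by rewrite mulnC divnMDl ?divn_small ?addn0 //; have := ltn_ord (x j); lia.
move=> z _; apply/ffunP => j; rewrite !ffunE; apply: val_inj => /=.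
by rewrite mulnC -divn_eq.
Qed.

(** By Lucas modulo 2, the binary digits of each [I j] are among those of [D j]. The binomials are
    kept because they are the coefficients met when a monomial is restricted to a line. *)
Definition submask I D : Prop := forall j, odd 'C(D j, I j).

(* [survivors n c] counts the [m * n] bit matrices on which a carry that starts
   as large as [c] can be propagated through [n] positions, producing the digit
   [1] at each; the greatest possible carry is passed on. *)
Fixpoint survivors (n c : nat) : nat :=
  if n is n'.+1 then
    \sum_(x : {set 'I_m}) (0 < #|x| + c) * survivors n' (#|x| + c).-1./2
  else 1.

(** [cong_ones] and [sum_ones] both make the [n] low digits of [\sum_j I j + c'] equal to 1;
    [sum_ones] also forbids higher digits. The weaker property is counted from above by [survivors]
    and the stronger one from below, as the two sides of the estimate require. *)
Definition cong_ones (n c : nat) D : Prop :=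
  exists2 I, submask I D & exists2 c', c' <= c & 2 ^ n %| \sum_j I j + c' + 1.

Definition sum_ones (n c : nat) D : Prop :=
  exists2 I, submask I D & exists2 c', c' <= c & \sum_j I j + c' + 1 = 2 ^ n.

Lemma sum_set (f : {set 'I_m} -> nat) :
  \sum_(x : {set 'I_m}) f x = \sum_(x : {ffun 'I_m -> 'I_2}) f [set j | x j == 1%N :> nat].
Proof.
rewrite (reindex (fun x : {ffun 'I_m -> 'I_2} => [set j | x j == 1%N :> nat])) //.
exists (fun A : {set 'I_m} => [ffun j => inord (j \in A)]) => x _.
  apply/ffunP => j; rewrite !ffunE inE; apply: val_inj => /=; rewrite inordK.
    by have := ltn_ord (x j); case: (x j : nat) => [|[|]].
  by case: (_ == _).
by apply/setP => j; rewrite inE ffunE inordK; case: (j \in x).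
Qed.

Lemma card_bits (x : {ffun 'I_m -> 'I_2}) :
  #|[set j | x j == 1%N :> nat]| = \sum_j x j.
Proof.
rewrite -sum1_card big_mkcond; apply: eq_bigr => j _; rewrite inE.
by have := ltn_ord (x j); case: (x j : nat) => [|[|]].
Qed.

Lemma odd_bin_half D I (j : 'I_m) (t : nat) : t < 2 ->
  odd 'C(2 * D j + t, I j) -> odd 'C(D j, I j %/ 2) /\ I j %% 2 <= t.
Proof.
move=> ht; rewrite {1}(divn_eq (I j) 2) [_ %/ 2 * 2]mulnC.
have := odd_binD2 (D j) (t == 1) (I j %/ 2) (I j %% 2 == 1).
have -> : (t == 1) = t :> nat by lia.
have -> : (I j %% 2 == 1) = I j %% 2 :> nat by lia.
by move=> -> /andP[].
Qed.

(** If [u] low bits are selected, a lowest digit 1 forces [u + c' = 2 * k + 1]. The carry [k] is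
    then at most half of the column weight plus [c] minus one, and the divisibility can be
    halved. *)
Lemma cong_ones_step n c D (x : {ffun 'I_m -> 'I_2}) :
  cong_ones n.+1 c [ffun j => 2 * D j + x j] ->
  0 < \sum_j x j + c /\ cong_ones n (\sum_j x j + c).-1./2 D.
Proof.
move=> [I hI [c' hc']].
have hI' j := odd_bin_half (ltn_ord (x j)) (etrans (esym (congr1 (fun d => odd 'C(d, I j))
   (ffunE (fun j => 2 * D j + x j) j))) (hI j)).
pose u := \sum_j I j %% 2.
have hu : u <= \sum_j x j by apply: leq_sum => j _; case: (hI' j).
have -> : \sum_j I j = 2 * \sum_j (I j %/ 2) + u.
  by rewrite big_distrr -big_split; apply: eq_bigr => j _; rewrite /= mulnC -divn_eq.
rewrite expnS => hd.
have [k hk] : exists k, u + c' = 2 * k + 1.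
  exists (u + c').-1./2.
  have : 2 %| 2 * \sum_j I j %/ 2 + u + c' + 1 by apply: dvdn_trans hd; apply: dvdn_mulr.
  lia.
split; first lia.
exists [ffun j => I j %/ 2]; first by move=> j; rewrite ffunE; case: (hI' j).
exists k; first lia.
move: hd; have -> : 2 * \sum_j I j %/ 2 + u + c' + 1 = 2 * (\sum_j I j %/ 2 + k + 1) by lia.
rewrite dvdn_pmul2l //; congr (_ %| _ + _ + _).
by apply: eq_bigr => j _; rewrite ffunE.
Qed.

(** This is why the possible carries form an interval: every number up to the weight of a column is
    the weight of a submask, obtained by adding one bit at a time. *)
Lemma choose_bits (x : {ffun 'I_m -> 'I_2}) u : u <= \sum_j x j ->
  exists2 t : {ffun 'I_m -> bool}, (forall j, t j <= x j) & \sum_j t j = u.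
Proof.
elim: u => [|u IHu] h.
  by exists [ffun=> false] => [j|]; rewrite ?ffunE // big1 // => j _; rewrite ffunE.
have [t ht hs] := IHu (ltnW h).
have [j hj] : exists j, t j < x j.
  apply/existsP; apply: contraTT h; rewrite negb_exists => /forallP h'.
  rewrite -leqNgt -hs; apply: leq_sum => j _; have := h' j; lia.
exists [ffun i => t i || (i == j)] => [i|].
  rewrite ffunE; have := ht i; case: eqP => [->|_]; rewrite ?orbT ?orbF //; lia.
rewrite (bigD1 j) //= ffunE eqxx orbT -hs (bigD1 (P := predT) j) //=.
have hx := ltn_ord (x j).
have -> : nat_of_bool (t j) = 0 by lia.
by congr (_.+1); apply: eq_bigr => i /negbTE hi; rewrite ffunE hi orbF.
Qed.

Lemma sum_ones_step n c D (x : {ffun 'I_m -> 'I_2}) :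
  0 < \sum_j x j + c -> sum_ones n (\sum_j x j + c).-1./2 D ->
  sum_ones n.+1 c [ffun j => 2 * D j + x j].
Proof.
move=> h0 [I hI [k hk hs]].
(* To send out the carry [k], the selected bits and the incoming carry must add up to [2 * k + 1],
   which is at most the weight plus [c]. The bits supply as much as they can and the remainder, at
   most [c], comes from the carry. *)
have [t ht hu] : exists2 t : {ffun 'I_m -> bool}, (forall j, t j <= x j) &
    \sum_j t j = minn (2 * k + 1) (\sum_j x j) by apply: choose_bits; apply: geq_minr.
exists [ffun j => 2 * I j + t j].
  move=> j; rewrite !ffunE.
  have := odd_binD2 (D j) (x j == 1%N :> nat) (I j) (t j).
  have hx := ltn_ord (x j).
  have -> : (x j == 1%N :> nat) = x j :> nat by lia.
  by rewrite ht andbT => ->; exact: hI.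
exists (2 * k + 1 - \sum_j t j); first by rewrite hu; lia.
have -> : \sum_j [ffun j => 2 * I j + t j] j = 2 * \sum_j I j + \sum_j t j.
  by rewrite big_distrr -big_split; apply: eq_bigr => j _; rewrite ffunE.
rewrite expnS -hs; lia.
Qed.

Lemma cong_ones_count n c :
  box_count (2 ^ n) (fun D => `[< cong_ones n c D >]) <= survivors n c.
Proof.
elim: n c => [|n IHn] c.
  rewrite /box_count (eq_bigr (fun=> 1)) ?sum1_card ?card_ffun ?card_ord ?exp1n //.
  move=> D _; apply/eqP; rewrite eqb1; apply/asboolP.
  exists [ffun=> 0] => [j|]; first by rewrite !ffunE bin0.
  by exists 0 => //; rewrite dvd1n.
rewrite expnS box_countM /= sum_set; apply: leq_sum => x _; rewrite card_bits.
have [h0|h0] := boolP (0 < _); rewrite ?mul1n ?mul0n.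
  apply: leq_trans (IHn _); apply: leq_box_count => D _ /asboolP h.
  by apply/asboolP; have [] := cong_ones_step h.
(* A zero column without incoming carry only yields the digit 0. *)
rewrite /box_count big1 // => D _; apply/eqP; rewrite eqb0.
apply/negP => /asboolP h.
by move: h0; have [-> _] := cong_ones_step h.
Qed.

Lemma sum_ones_count n c :
  survivors n c <= box_count (2 ^ n) (fun D => `[< sum_ones n c D >]).
Proof.
elim: n c => [|n IHn] c.
  rewrite /box_count (eq_bigr (fun=> 1)) ?sum1_card ?card_ffun ?card_ord ?exp1n //.
  move=> D _; apply/eqP; rewrite eqb1; apply/asboolP.
  exists [ffun=> 0] => [j|]; first by rewrite !ffunE bin0.
  by exists 0 => //; rewrite big1 // => j _; rewrite ffunE.
rewrite expnS box_countM /= sum_set; apply: leq_sum => x _; rewrite card_bits.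
have [h0|h0] := boolP (0 < _); rewrite ?mul1n ?mul0n //.
apply: leq_trans (IHn _) _; apply: leq_box_count => D _ /asboolP h.
by apply/asboolP/sum_ones_step.
Qed.

(* Exponent to which ['X^M] reduces modulo ['X^q - 'X]. *)
Definition fold_exp (q M : nat) : nat := if M is M'.+1 then (M' %% q.-1).+1 else 0.

Definition bad_exp (q d : nat) D : Prop :=
  exists2 I, submask I D & d <= fold_exp q (\sum_j I j).

Lemma submask_split s D x I : (forall j, x j < 2 ^ s) ->
  submask I [ffun j => 2 ^ s * D j + x j] <->
  submask [ffun j => I j %/ 2 ^ s] D /\ submask [ffun j => I j %% 2 ^ s] [ffun j => x j].
Proof.
move=> hx.
have e j : odd 'C(2 ^ s * D j + x j, I j)
         = odd 'C(D j, I j %/ 2 ^ s) && odd 'C(x j, I j %% 2 ^ s).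
  rewrite {1}(divn_eq (I j) (2 ^ s)) [_ %/ _ * _]mulnC odd_bin_split //.
  by rewrite ltn_mod expn_gt0.
split=> [h|[h1 h2] j].
  by split=> j; rewrite !ffunE; have := h j; rewrite ffunE e => /andP[].
by have := h1 j; have := h2 j; rewrite !ffunE e => -> ->.
Qed.

(** A submask of the top bits with sum [2 ^ n - 1], shifted by [s], has sum [q - 2 ^ s] for
    [q = 2 ^ (s + n)]. This is at least [q - r] and is not changed by folding. The low bits stay
    arbitrary, which gives the factor [(2 ^ s) ^ m]. *)
Lemma bad_exp_lower s n r :
  2 ^ s <= r -> 
  (2 ^ s) ^ m * survivors n 0 <=
  box_count (2 ^ (s + n)) (fun D => `[< bad_exp (2 ^ (s + n)) (2 ^ (s + n) - r) D >]).
Proof.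
move=> hr; rewrite {1}expnD box_countM.
have -> : (2 ^ s) ^ m = #|{ffun 'I_m -> 'I_(2 ^ s)}| by rewrite card_ffun !card_ord.
rewrite -sum1_card big_distrl /=; apply: leq_sum => x _; rewrite mul1n.
apply: leq_trans (sum_ones_count n 0) _; apply: leq_box_count => D _ /asboolP.
move=> [I hI [c']]; rewrite leqn0 => /eqP -> hs; apply/asboolP.
exists [ffun j => 2 ^ s * I j].
  apply/submask_split => //; split=> j; rewrite !ffunE.
    by rewrite mulKn ?expn_gt0 //; apply: hI.
  by rewrite modnMr bin0.
have -> : \sum_j [ffun j => 2 ^ s * I j] j = 2 ^ (s + n) - 2 ^ s.
  rewrite expnD -hs (eq_bigr (fun j => 2 ^ s * I j)); last by move=> j _; rewrite ffunE.
  by rewrite -big_distrr /=; lia.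
have h2s : 0 < 2 ^ s by rewrite expn_gt0.
rewrite /fold_exp; case e: (_ - 2 ^ s) => [|M]; first lia.
rewrite modn_small; lia.
Qed.

(** For fixed low bits, the low parts of the submask and the folding modulo [q - 1] together act on
    the top bits as one incoming carry, which is at most [m - 1]. *)
Lemma bad_exp_upper s n r :
  0 < m -> 0 < r -> r < 2 ^ s -> r < 2 ^ (s + n) ->
  box_count (2 ^ (s + n)) (fun D => `[< bad_exp (2 ^ (s + n)) (2 ^ (s + n) - r) D >])
  <= (2 ^ s) ^ m * survivors n m.-1.
Proof.
move=> m_gt0 r_gt0 hr hr'; rewrite {1}expnD box_countM.
have -> : (2 ^ s) ^ m = #|{ffun 'I_m -> 'I_(2 ^ s)}| by rewrite card_ffun !card_ord.
rewrite -sum1_card big_distrl /=; apply: leq_sum => x _; rewrite mul1n.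
apply: leq_trans (cong_ones_count n _); apply: leq_box_count => D hD /asboolP.
have hx j := ltn_ord (x j).
move=> [I hI hf]; apply/asboolP.
have hIq j : I j <= (2 ^ (s + n)).-1.
  apply: (@leq_trans (2 ^ s * D j + x j)).
    by rewrite leqNgt; apply/negP => h; have := hI j; rewrite ffunE bin_small.
  by rewrite expnD; have := hD j; have := hx j; nia.
have [hI1 _] := (submask_split D I hx).1 hI.
exists [ffun j => I j %/ 2 ^ s] => //.
have hM : \sum_j I j <= m * (2 ^ (s + n)).-1.
  rewrite -[X in X * _]card_ord -sum_nat_const; apply: leq_sum => j _; exact: hIq.
move: hf; set q := 2 ^ (s + n) in hr' hIq hM *; set M := \sum_j I j in hM *.
rewrite /fold_exp; case eM: M => [|M']; first lia.
move=> hR; pose k := M' %/ q.-1; have hdiv := divn_eq M' q.-1.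
have q1 : 0 < q.-1 by lia.
have hk : k < m by rewrite /k ltn_divLR //; lia.
have hmod := ltn_pmod M' q1.
pose lo := \sum_j I j %% 2 ^ s; pose hi := \sum_j I j %/ 2 ^ s.
have s_gt0 : 0 < 2 ^ s by rewrite expn_gt0.
have hlo : lo <= m * (2 ^ s).-1.
  rewrite -[X in X * _]card_ord -sum_nat_const; apply: leq_sum => j _.
  by have := ltn_pmod (I j) s_gt0; lia.
have ehi : M = 2 ^ s * hi + lo.
  by rewrite big_distrr -big_split; apply: eq_bigr => j _; rewrite /= mulnC -divn_eq.
(* Folding subtracts [q - 1] exactly [k] times, so [M + k] is [k * q] plus the folded exponent. The
   carry into the top bits is therefore that of [lo + k], and [lo + k < m * 2 ^ s]. *)
exists ((lo + k) %/ 2 ^ s).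
  rewrite -ltnS prednK // ltn_divLR //; nia.
have -> : \sum_j [ffun j => I j %/ 2 ^ s] j = hi by apply: eq_bigr => j _; rewrite ffunE.
have eq : q = 2 ^ s * 2 ^ n by rewrite /q expnD.
have n_gt0 : 0 < 2 ^ n by rewrite expn_gt0.
apply/dvdnP; exists k.+1.
set c := (lo + k) %/ 2 ^ s; have hc := divn_eq (lo + k) (2 ^ s).
have hcm := ltn_pmod (lo + k) s_gt0.
rewrite -/k -/c in hdiv hc *.
have key : 2 ^ s * (hi + c) + (lo + k) %% 2 ^ s = M' %% q.-1 + 1 + k * q by nia.
set Y := 2 ^ n in eq n_gt0 *; set S := 2 ^ s in eq s_gt0 hr hcm key *.
have eSY : S * (k.+1 * Y) = k * q + q by rewrite eq; lia.
(* The folded exponent lies between [q - r] and [q - 1] with [r < S], so [M + k] is less than [S]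
   below the multiple [k.+1 * q] of [S]. Hence [hi + c + 1 = k.+1 * Y]. *)
have l1 : S * (hi + c) < S * (k.+1 * Y) by rewrite eSY; lia.
have l2 : S * (k.+1 * Y) < S * (hi + c + 2) by rewrite eSY; lia.
by rewrite !ltn_pmul2l // in l1 l2; lia.
Qed.
End Digits.

Local Open Scope ring_scope.

(** * Monomial basis of the code *)

Section Interpolation.
Variable F : finFieldType.
Local Notation q := #|F|.

Lemma card_field_gt1 : (1 < q)%N.
Proof. exact: finNzRing_gt1. Qed.

Lemma indicator_pow (x : F) : 1 - x ^+ q.-1 = (x == 0)%:R.
Proof.
have q1 := card_field_gt1.
have [->|x0] := eqVneq; first by rewrite expr0n (_ : (q.-1 == 0)%N = false) ?subr0 ?eqxx //; lia.
apply/eqP; rewrite subr_eq0 eq_sym; apply/eqP/(mulfI x0).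
by rewrite -exprS mulr1 prednK ?expf_card //; lia.
Qed.

Definition lagrange (y : F) : {poly F} := 1 - ('X - y%:P) ^+ q.-1.

Lemma horner_lagrange y z : (lagrange y).[z] = (z == y)%:R.
Proof. by rewrite /lagrange !hornerE indicator_pow subr_eq0. Qed.

Lemma size_lagrange y : (size (lagrange y) <= q)%N.
Proof.
have q1 := card_field_gt1.
apply: leq_trans (size_polyD _ _) _; rewrite geq_max size_poly1 size_polyN size_exp_XsubC.
by rewrite prednK //; lia.
Qed.

Lemma poly_interpolation (p : {poly F}) : (size p <= q)%N ->
  p = \sum_y p.[y] *: lagrange y.
Proof.
move=> hp; apply/eqP; rewrite -subr_eq0; apply/eqP.
apply: (@roots_geq_poly_eq0 _ _ (enum F)).
- apply/allP => z _; rewrite /root !hornerE horner_sum (bigD1 z) //= big1 => [|y hy].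
    by rewrite hornerZ horner_lagrange eqxx mulr1 addr0 subrr.
  by rewrite hornerZ horner_lagrange eq_sym (negbTE hy) mulr0.
- exact: enum_uniq.
rewrite -cardE; apply: leq_trans (size_polyD _ _) _; rewrite geq_max hp size_polyN /=.
apply: leq_trans (size_sum _ _ _) _; apply/bigmax_leqP => y _.
exact: leq_trans (size_scale_leq _ _) (size_lagrange y).
Qed.

(** The kernel of a linear functional on functions: summing a function against it gives the
    coefficient of ['X^k] in its interpolating polynomial of size at most [q]. *)
Definition coef_weight (k : nat) (y : F) : F := (lagrange y)`_k.

Lemma coef_weightP (p : {poly F}) k : (size p <= q)%N ->
  \sum_y p.[y] * coef_weight k y = p`_k.
Proof.
move=> hp; rewrite [in RHS](poly_interpolation hp) coef_sum.
by apply: eq_bigr => y _; rewrite coefZ.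
Qed.

Lemma coef_weight_pow n k : (n < q)%N -> \sum_y y ^+ n * coef_weight k y = (n == k)%:R.
Proof.
move=> hn; rewrite (eq_bigr (fun y => 'X^n.[y] * coef_weight k y)).
  by rewrite coef_weightP ?size_polyXn // coefXn eq_sym.
by move=> y _; rewrite hornerXn.
Qed.

Lemma coef_weight_dual x y : \sum_(k < q) x ^+ k * coef_weight k y = (x == y)%:R.
Proof.
rewrite -horner_lagrange (horner_coef_wide _ (size_lagrange y)).
by apply: eq_bigr => k _; rewrite mulrC.
Qed.

Lemma fold_exp_lt n : (fold_exp q n < q)%N.
Proof.
have q1 := card_field_gt1; case: n => [|n]; first exact: ltnW.
rewrite /fold_exp; have : (n %% q.-1 < q.-1)%N by rewrite ltn_mod; lia.
lia.
Qed.

(** This rests on [x ^+ q = x]. Positive exponents fold into [1 .. q - 1], apart from the exponent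
    0, because [x ^+ 0] and [x ^+ q.-1] differ at [x = 0]. *)
Lemma pow_fold_exp (x : F) n : x ^+ n = x ^+ fold_exp q n.
Proof.
have q1 := card_field_gt1; case: n => // n /=.
have hx : x * x ^+ q.-1 = x by rewrite -exprS prednK ?expf_card //; lia.
rewrite {1}(divn_eq n q.-1) -addnS; elim: (n %/ q.-1)%N => // k IHk.
rewrite mulSn -addnA addnC exprD {}IHk.
by rewrite exprS mulrAC hx.
Qed.

Lemma coef_weight_fold n k : \sum_y y ^+ n * coef_weight k y = (fold_exp q n == k)%:R.
Proof.
rewrite -coef_weight_pow ?fold_exp_lt //.
by apply: eq_bigr => y _; rewrite -pow_fold_exp.
Qed.

End Interpolation.

(** * Monomial coefficients of functions and of codewords *)

Section MonomialBasis.
Variables (F : finFieldType) (m : nat).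
Local Notation q := #|F|.
Local Notation expo := {ffun 'I_m -> 'I_q}.
Local Notation "[# e ]" := (fun j => nat_of_ord (e j)) (format "[# e ]").
Implicit Types (x y a b : 'rV[F]_m) (e i : expo) (c : {ffun 'rV[F]_m -> F^o}).

Definition monomial (e : 'I_m -> nat) x : F := \prod_j x 0 j ^+ e j.
(** The system dual to the monomials: [weight_monomial] and [weight_dual] express that the two
    matrices indexed by points and exponents are inverse to each other. *)
Definition weight (e : 'I_m -> nat) x : F := \prod_j coef_weight (e j) (x 0 j).

Lemma sum_row_prod (G : 'I_m -> F -> F) :
  \sum_(x : 'rV[F]_m) \prod_j G j (x 0 j) = \prod_j \sum_t G j t.
Proof.
rewrite bigA_distr_bigA /= (reindex (fun x : 'rV[F]_m => [ffun j => x 0 j])) /=.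
  by apply: eq_bigr => x _; apply: eq_bigr => j _; rewrite ffunE.
exists (fun f : {ffun 'I_m -> F} => \row_j f j) => [x _|f _].
  by apply/rowP => j; rewrite mxE ffunE.
by apply/ffunP => j; rewrite ffunE mxE.
Qed.

Lemma prod_eq_nat (e e' : 'I_m -> nat) :
  \prod_j (e j == e' j)%:R = [forall j, e j == e' j]%:R :> F.
Proof.
have [/forallP h|] := boolP [forall j, e j == e' j].
  by rewrite big1 // => j _; rewrite (eqP (h j)) eqxx.
by rewrite negb_forall => /existsP[j /negbTE hj]; rewrite (bigD1 j) //= hj mul0r.
Qed.

Lemma weight_monomial (e e' : 'I_m -> nat) : (forall j, (e j < q)%N) ->
  \sum_(x : 'rV[F]_m) monomial e x * weight e' x = [forall j, e j == e' j]%:R.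
Proof.
move=> he; rewrite -prod_eq_nat.
rewrite (eq_bigr (fun x : 'rV_m => \prod_j (x 0 j ^+ e j * coef_weight (e' j) (x 0 j)))).
  rewrite (sum_row_prod (fun j t => t ^+ e j * coef_weight (e' j) t)).
  by apply: eq_bigr => j _; rewrite coef_weight_pow.
by move=> x _; rewrite -big_split.
Qed.

Lemma weight_dual x y : \sum_(e : expo) monomial [#e] x * weight [#e] y = (x == y)%:R.
Proof.
rewrite (eq_bigr (fun e : expo => \prod_j (x 0 j ^+ e j * coef_weight (e j) (y 0 j)))).
  rewrite -(bigA_distr_bigA (fun j (k : 'I_q) => x 0 j ^+ k * coef_weight k (y 0 j))).
  rewrite (eq_bigr (fun j => (x 0 j == y 0 j)%:R)).
    have [->|hxy] := eqVneq x y; first by rewrite big1 // => j _; rewrite eqxx.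
    have [j hj] : exists j, x 0 j != y 0 j.
      apply/existsP; apply: contraNT hxy; rewrite negb_exists => /forallP h.
      by apply/eqP/rowP => j; apply/eqP; have := h j; rewrite negbK.
    by rewrite (bigD1 j) //= (negbTE hj) mul0r.
  by move=> j _; rewrite coef_weight_dual.
by move=> e _; rewrite -big_split.
Qed.

Definition mono_coef (c : {ffun 'rV[F]_m -> F^o}) (e : 'I_m -> nat) : F :=
  \sum_(x : 'rV[F]_m) c x * weight e x.

Lemma mono_expansion c x : c x = \sum_(e : expo) mono_coef c [#e] * monomial [#e] x.
Proof.
rewrite (eq_bigr (fun e : expo => \sum_(y : 'rV[F]_m) c y * (monomial [#e] x * weight [#e] y))).
  rewrite exchange_big (bigD1 x) //= -big_distrr /= weight_dual eqxx mulr1 big1 ?addr0 //.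
  by move=> y hy; rewrite -big_distrr /= weight_dual eq_sym (negbTE hy) mulr0.
move=> e _; rewrite big_distrl; apply: eq_bigr => y _ /=.
by rewrite -mulrA [weight _ _ * _]mulrC.
Qed.

Lemma horner_mmap (f : mpoly.mpoly m F) (h : 'I_m -> {poly F}) t :
  (mpoly.mmap (@polyC F) h f).[t] = mpoly.meval (fun j => (h j).[t]) f.
Proof.
rewrite /mpoly.meval /mpoly.mmap horner_sum; apply: eq_bigr => k _.
rewrite hornerM hornerC /mpoly.mmap1 horner_prod; congr (_ * _).
by apply: eq_bigr => j _; rewrite horner_exp.
Qed.

Lemma size_XqX : size ('X^q - 'X : {poly F}) = q.+1.
Proof.
by rewrite size_polyDl size_polyXn // size_polyN size_polyX ltnS card_field_gt1.
Qed.

Lemma size_line_restr (f : mpoly.mpoly m F) a b : (size (line_restr f a b) <= q)%N.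
Proof. by rewrite -ltnS -size_XqX ltn_modp -size_poly_eq0 size_XqX. Qed.

Lemma horner_line_restr (f : mpoly.mpoly m F) a b t :
  (line_restr f a b).[t] = evaluation f (t *: a + b).
Proof.
rewrite /line_restr; set p := mpoly.mmap _ _ _; set d := _ - _.
have -> : (p %% d).[t] = p.[t].
  rewrite [in RHS](divp_eq p d) hornerD hornerM.
  by rewrite [d.[t]]hornerD hornerN hornerXn hornerX expf_card subrr mulr0 add0r.
rewrite horner_mmap ffunE; apply: mpoly.meval_eq => j.
by rewrite !hornerE !mxE mulrC.
Qed.

Lemma coef_line_restr (f : mpoly.mpoly m F) a b k :
  (line_restr f a b)`_k = \sum_t evaluation f (t *: a + b) * coef_weight k t.
Proof.
rewrite -(coef_weightP _ (size_line_restr f a b)).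
by apply: eq_bigr => t _; rewrite horner_line_restr.
Qed.

Lemma evaluation_surj (c : {ffun 'rV[F]_m -> F^o}) :
  exists f : mpoly.mpoly m F, c = evaluation f.
Proof.
exists (\sum_(e : expo) mono_coef c [#e] *: mpoly.mpolyX F (mpoly.Multinom [tuple (e j : nat) | j < m])).
apply/ffunP => x; rewrite ffunE mono_expansion raddf_sum /=; apply: eq_bigr => e _.
rewrite mpoly.mevalZ mpoly.mevalX; congr (_ * _); apply: eq_bigr => j _.
by rewrite mpoly.mnmE.
Qed.

(** Every function is the evaluation of a polynomial, so membership depends on the values alone;
    high coefficients on a line are read off by [coef_weight]. *)
Lemma codewordP d (c : {ffun 'rV[F]_m -> F^o}) :
  lifted_RS_codeword d c <->
  forall a b k, (d <= k)%N -> \sum_t c (t *: a + b) * coef_weight k t = 0.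
Proof.
split=> [[f hf ->] a b k hk|h].
  by rewrite -coef_line_restr nth_default //; apply: leq_trans (hf a b) hk.
have [f hf] := evaluation_surj c; exists f => // a b.
by apply/leq_sizeP => k hk; rewrite coef_line_restr -hf h.
Qed.

(** Terms with [i > k] vanish with their binomial. The common range [i < q] allows the product over
    coordinates to be distributed over exponent vectors. *)
Lemma binomial_expansion (u v : F) (k : 'I_q) :
  (u + v) ^+ k = \sum_(i < q) 'C(k, i)%:R * (u ^+ i * v ^+ (k - i)).
Proof.
rewrite addrC exprDn (big_ord_widen q (fun l : nat => v ^+ (k - l) * u ^+ l *+ 'C(k, l))) //.
rewrite big_mkcond; apply: eq_bigr => i _.
case: ltnP => [_|hi]; first by rewrite mulr_natl mulrC.
by rewrite bin_small // mul0r.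
Qed.

Lemma monomial_line e a b k :
  \sum_t monomial [#e] (t *: a + b) * coef_weight k t =
  \sum_(i : expo) (fold_exp q (\sum_j i j) == k)%:R * (\prod_j 'C(e j, i j)%:R)
     * (monomial [#i] a * monomial (fun j => e j - i j)%N b).
Proof.
rewrite (eq_bigr (fun t => \sum_(i : expo) (t ^+ (\sum_j i j) * coef_weight k t) *
   ((\prod_j 'C(e j, i j)%:R) * (monomial [#i] a * monomial (fun j => e j - i j)%N b)))).
  rewrite exchange_big; apply: eq_bigr => i _.
  by rewrite -big_distrl /= coef_weight_fold mulrA.
move=> t _; rewrite /monomial.
rewrite (eq_bigr (fun j => \sum_(k < q) 'C(e j, k)%:R *
   (t ^+ k * a 0 j ^+ k * b 0 j ^+ (e j - k)))); last first.
  move=> j _; rewrite !mxE binomial_expansion; apply: eq_bigr => k' _.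
  by rewrite exprMn.
rewrite bigA_distr_bigA big_distrl; apply: eq_bigr => i _ /=.
rewrite !big_split /= -expr_sum; ring.
Qed.

Hypothesis F_char2 : 2%N \in [pchar F].

Lemma natf_odd n : (n%:R == 0 :> F) = ~~ odd n.
Proof. by rewrite -(dvdn_pcharf F_char2) dvdn2. Qed.

Lemma prod_bin_neq0 e i :
  (\prod_j 'C(e j, i j)%:R != 0 :> F) <->
  submask [ffun j => i j : nat] [ffun j => e j : nat].
Proof.
split=> [/prodf_neq0 h j|h].
  by rewrite !ffunE; have := h j isT; rewrite natf_odd negbK.
by apply/prodf_neq0 => j _; have := h j; rewrite !ffunE natf_odd negbK.
Qed.

Definition bad_expo (d : nat) : pred expo :=
  fun e => `[< bad_exp q d [ffun j => e j : nat] >].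

Lemma bad_expoP d e :
  reflect (exists2 i : expo, submask [ffun j => i j : nat] [ffun j => e j : nat] &
             (d <= fold_exp q (\sum_j i j))%N) (bad_expo d e).
Proof.
apply: (iffP idP) => [/asboolP[i hi hd]|[i hi hd]]; last first.
  apply/asboolP; exists [ffun j => i j : nat] => //.
  by rewrite (eq_bigr (fun j => i j : nat)) // => j _; rewrite ffunE.
have hlt j : (i j < q)%N.
  apply: leq_ltn_trans (ltn_ord (e j)); rewrite leqNgt; apply/negP => h.
  by have := hi j; rewrite ffunE bin_small.
exists [ffun j => Ordinal (hlt j)].
  by move=> j; have := hi j; rewrite !ffunE.
by rewrite (eq_bigr i) // => j _; rewrite ffunE.
Qed.

Lemma sum_sum_mul (I J : finType) (K : F) (u : I -> F) (v : J -> F) :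
  \sum_a \sum_b K * (u a * v b) = K * ((\sum_a u a) * (\sum_b v b)).
Proof.
rewrite big_distrlr big_distrr; apply: eq_bigr => a _ /=.
by rewrite big_distrr.
Qed.

(** A coefficient of high degree in the line parameter is a polynomial in [a] and [b], in which a
    term with nonzero binomial product can only come from a bad [e]. Conversely, its coefficient at
    [a^i0 b^(e0 - i0)] is [mono_coef c e0] times a nonzero binomial product, so it forces
    [mono_coef c e0] to vanish. *)
Lemma codeword_coefP d (c : {ffun 'rV[F]_m -> F^o}) :
  lifted_RS_codeword d c <-> forall e, bad_expo d e -> mono_coef c [#e] = 0.
Proof.
have line a b k : \sum_t c (t *: a + b) * coef_weight k t =
   \sum_(e : expo) mono_coef c [#e] * \sum_(i : expo) (fold_exp q (\sum_j i j) == k)%:R *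
      (\prod_j 'C(e j, i j)%:R) * (monomial [#i] a * monomial (fun j => e j - i j)%N b).
  rewrite (eq_bigr (fun t => \sum_(e : expo) mono_coef c [#e] *
     (monomial [#e] (t *: a + b) * coef_weight k t))); last first.
    by move=> t _; rewrite mono_expansion big_distrl; apply: eq_bigr => e _ /=; rewrite mulrA.
  by rewrite exchange_big; apply: eq_bigr => e _; rewrite -big_distrr /= monomial_line.
rewrite codewordP; split=> h; last first.
  move=> a b k hk; rewrite line big1 // => e _.
  have [/h ->|he] := boolP (bad_expo d e); first by rewrite mul0r.
  rewrite big1 ?mulr0 // => i _.
  have [hi|hi] := eqVneq (\prod_j 'C(e j, i j)%:R : F) 0; first by rewrite hi mulr0 mul0r.
  case: eqP => [hik|_]; last by rewrite !mul0r.
  case/bad_expoP: he; exists i; first by apply/prod_bin_neq0.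
  by rewrite hik.
move=> e0 /bad_expoP[i0 hi0 hd].
pose k := fold_exp q (\sum_j i0 j).
have hle e i j : \prod_j 'C(e j, i j)%:R != 0 :> F -> (i j <= e j)%N.
  move=> /prod_bin_neq0 /(_ j); rewrite !ffunE leqNgt; apply: contraTN => hij.
  by rewrite bin_small.
have hp0 : \prod_j 'C(e0 j, i0 j)%:R != 0 :> F by apply/prod_bin_neq0.
(* Pairing with the dual weights in both [a] and [b] extracts the coefficient at
   [a^i0 b^(e0 - i0)]. *)
have : \sum_(a : 'rV[F]_m) \sum_(b : 'rV[F]_m) (weight [#i0] a * weight (fun j => e0 j - i0 j)%N b) *
         \sum_t c (t *: a + b) * coef_weight k t = 0.
  by rewrite big1 // => a _; rewrite big1 // => b _; rewrite h // mulr0.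
have -> : \sum_(a : 'rV[F]_m) \sum_(b : 'rV[F]_m) (weight [#i0] a * weight (fun j => e0 j - i0 j)%N b) *
         \sum_t c (t *: a + b) * coef_weight k t =
   \sum_(e : expo) \sum_(i : expo) mono_coef c [#e] * ((fold_exp q (\sum_j i j) == k)%:R *
     (\prod_j 'C(e j, i j)%:R) *
     ([forall j, i j == i0 j :> nat]%:R * [forall j, e j - i j == e0 j - i0 j :> nat]%N%:R)).
  transitivity (\sum_(a : 'rV[F]_m) \sum_(b : 'rV[F]_m) \sum_(e : expo) \sum_(i : expo) mono_coef c [#e] * ((fold_exp q (\sum_j i j) == k)%:R *
     (\prod_j 'C(e j, i j)%:R) * ((monomial [#i] a * weight [#i0] a) *
      (monomial (fun j => e j - i j)%N b * weight (fun j => e0 j - i0 j)%N b)))).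
    apply: eq_bigr => a _; apply: eq_bigr => b _; rewrite line big_distrr.
    apply: eq_bigr => e _; rewrite /= !big_distrr /=; apply: eq_bigr => i _ /=; ring.
  rewrite (eq_bigr _ (fun a _ => exchange_big _ _ _ _ _ _)) exchange_big.
  apply: eq_bigr => e _.
  rewrite (eq_bigr _ (fun a _ => exchange_big _ _ _ _ _ _)) exchange_big.
  apply: eq_bigr => i _ /=.
  under eq_bigr => a _ do under eq_bigr => b _ do rewrite [mono_coef _ _ * _]mulrA.
  rewrite sum_sum_mul -mulrA.
  rewrite !weight_monomial // => j.
  exact: leq_ltn_trans (leq_subr _ _) (ltn_ord (e j)).
rewrite (bigD1 e0) //= (bigD1 i0) //= [X in _ + X = _]big1 ?addr0; last first.
  move=> e he; rewrite big1 // => i _.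
  have [->|hp] := eqVneq (\prod_j 'C(e j, i j)%:R : F) 0; first by rewrite mulr0 mul0r mulr0.
  case: forallP => hi; last by rewrite mul0r !mulr0.
  case: forallP => hei; last by rewrite !mulr0.
  (* By [hle] no subtraction is truncated, so [i = i0] and [e - i = e0 - i0] give [e = e0]. *)
  case/eqP: he; apply/ffunP => j; apply: val_inj => /=.
  by rewrite -(subnK (hle _ _ j hp)) (eqP (hei j)) (eqP (hi j)) (subnK (hle _ _ j hp0)).
rewrite [X in _ + X]big1 ?addr0 => [|i hi]; last first.
  case: forallP => [hi'|_]; last by rewrite mul0r !mulr0.
  by case/eqP: hi; apply/ffunP => j; apply: val_inj; exact/eqP/hi'.
rewrite eqxx mul1r.
have -> : [forall j, i0 j == i0 j :> nat] by apply/forallP.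
have -> : [forall j, e0 j - i0 j == e0 j - i0 j :> nat]%N by apply/forallP.
by rewrite !mulr1 => /eqP; rewrite mulf_eq0 (negbTE hp0) orbF => /eqP.
Qed.

Definition mono_fun (e : expo) : {ffun 'rV[F]_m -> F^o} := [ffun x => monomial [#e] x].

Lemma mono_coef_fun e e' : mono_coef (mono_fun e) [#e'] = (e == e')%:R.
Proof.
rewrite /mono_coef (eq_bigr (fun x => monomial [#e] x * weight [#e'] x)); last first.
  by move=> x _; rewrite ffunE.
rewrite weight_monomial //; congr (nat_of_bool _)%:R.
apply/forallP/eqP => [h|-> //].
by apply/ffunP => j; apply: val_inj; exact/eqP/h.
Qed.

Lemma mono_coef_sum (I : Type) (s : seq I) (g : I -> F) (c : I -> {ffun 'rV[F]_m -> F^o})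
    (e : 'I_m -> nat) :
  mono_coef (\sum_(i <- s) g i *: c i) e = \sum_(i <- s) g i * mono_coef (c i) e.
Proof.
rewrite /mono_coef (eq_bigr (fun x => \sum_(i <- s) g i * (c i x * weight e x))).
  by rewrite exchange_big; apply: eq_bigr => i _; rewrite big_distrr.
move=> x _; rewrite sum_ffunE big_distrl; apply: eq_bigr => i _ /=.
by rewrite ffunE /= -mulrA.
Qed.

(** The good monomials form a basis of the code: they span it by [codeword_coefP], and the
    coefficient functionals show that they are free. *)
Lemma dim_lifted_RS d :
  (\dim (lifted_RS F m d) + #|bad_expo d| = q ^ m)%N.
Proof.
pose X := [seq mono_fun e | e <- enum [predC bad_expo d]].
have freeX : free X.
  rewrite -[X]/(val (in_tuple X)); apply/freeP => g hg i.
  have hsz : size X = size (enum [predC bad_expo d]) by rewrite size_map.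
  have hi : (i < size (enum [predC bad_expo d]))%N by rewrite -hsz.
  have e0 : expo by case: (enum _) hi => // e.
  pose E (k : nat) := nth e0 (enum [predC bad_expo d]) k.
  have := congr1 (fun c => mono_coef c [#E i]) hg.
  rewrite mono_coef_sum (bigD1 i) //= (nth_map e0) // mono_coef_fun eqxx mulr1.
  rewrite big1 ?addr0 => [->|k hk].
    by rewrite /mono_coef big1 // => x _; rewrite ffunE mul0r.
  have hk' : (k < size (enum [predC bad_expo d]))%N by rewrite -hsz.
  rewrite (nth_map e0) // mono_coef_fun nth_uniq ?enum_uniq //.
  by rewrite (_ : (k == i :> nat) = false) ?mulr0 //; apply/negbTE.
have -> : lifted_RS F m d = <<X>>%VS.
  apply/eqP; rewrite eqEsubv; apply/andP; split; last first.
    apply/span_subvP => c /mapP[e]; rewrite mem_enum inE => he ->.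
    apply/lifted_RSP/codeword_coefP => e' he'; rewrite mono_coef_fun.
    by case: eqP he' => // <- h; case/negP: he.
  apply/subvP => c /lifted_RSP/codeword_coefP hc.
  have -> : c = \sum_(e : expo) mono_coef c [#e] *: mono_fun e.
    apply/ffunP => x; rewrite sum_ffunE mono_expansion.
    by apply: eq_bigr => e _; rewrite !ffunE.
  apply: memv_suml => e _.
  have [/hc ->|he] := boolP (bad_expo d e); first by rewrite scale0r mem0v.
  by apply/memvZ/memv_span/map_f; rewrite mem_enum inE.
have -> : \dim <<X>> = size X by apply/eqP.
rewrite size_map -cardE addnC cardC card_ffun !card_ord //.
Qed.

Lemma rate_lifted_RS (R : realType) d :
  1 - rate R (lifted_RS F m d) =
  (box_count (m := m) q (fun D => `[< bad_exp q d D >]))%:R / (q ^ m)%:R.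
Proof.
rewrite /rate card_mx mul1n.
have -> : box_count (m := m) q (fun D => `[< bad_exp q d D >]) = #|bad_expo d|.
  transitivity (\sum_(e : expo) if bad_expo d e then 1 else 0)%N.
    by apply: eq_bigr => e _; rewrite /bad_expo; case: asbool.
  by rewrite -big_mkcond sum1_card.
have q0 : (q ^ m)%:R != 0 :> R.
  by rewrite pnatr_eq0 expn_eq0; have := card_field_gt1 F; lia.
rewrite -[in X in X - _](divff q0) -mulrBl -[X in X%:R - _](dim_lifted_RS d).
by rewrite natrD [_%:R + _]addrC addrK.
Qed.
End MonomialBasis.

(** * Perron vectors *)

Section CollatzWielandt.
Import numFieldNormedType.Exports.
Variables (R : realType) (p : nat) (A : 'M[R]_p.+1).
Hypothesis A_ge0 : forall i j, 0 <= A i j.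
Implicit Types (y x : 'rV[R]_p.+1) (t S : R).

Definition nonneg_vec y := (forall c, 0 <= y 0 c) /\ y != 0.
Definition superinvariant t y := forall c, t * y 0 c <= (y *m A) 0 c.

Lemma nonneg_vec_sum_gt0 y : nonneg_vec y -> 0 < \sum_c y 0 c.
Proof.
move=> [y0 yn0]; rewrite lt_neqAle sumr_ge0 // andbT eq_sym.
apply: contraNneq yn0 => /eqP; rewrite psumr_eq0 // => /allP h.
by apply/eqP/rowP => c; rewrite mxE; apply/eqP/h; rewrite mem_index_enum.
Qed.

(** Sum the inequalities over [c] and bound each [y 0 j] by the sum of all coordinates. This
    confines [t] to a compact interval. *)
Lemma superinvariant_bound t y :
  nonneg_vec y -> superinvariant t y -> t <= \sum_c \sum_j A j c.
Proof.
move=> hy ht; have s0 := nonneg_vec_sum_gt0 hy; have [y0 _] := hy.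
rewrite -(ler_pM2r s0) big_distrr /=.
apply: le_trans (ler_sum _ (fun c _ => ht c)) _.
rewrite big_distrl /=; apply: ler_sum => c _; rewrite mxE big_distrl /=.
apply: ler_sum => j _; rewrite mulrC; apply: ler_wpM2l => //.
by rewrite (bigD1 j) //= lerDl sumr_ge0.
Qed.

Lemma continuous_coord_sum n (k : 'I_n -> R) (f : 'I_n -> 'I_p.+2) :
  continuous (fun w : 'rV[R]_p.+2 => \sum_j k j * w 0 (f j)).
Proof.
move=> w; apply: (cvg_big add_continuous (F := nbhs w)) => j _.
by apply: cvgM; [exact: cvg_cst | exact: coord_continuous].
Qed.

Lemma closed_preimage (f : 'rV[R]_p.+2 -> R) (B : set R) :
  continuous f -> closed B -> closed (f @^-1` B)%classic.
Proof. by move=> /continuous_closedP; apply. Qed.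

Lemma collatz_wielandt :
  exists S y, [/\ nonneg_vec y, superinvariant S y &
    forall t x, nonneg_vec x -> superinvariant t x -> t <= S].
Proof.
(* Maximise the coordinate [t = w_0] over the compact set of pairs [(t, y)]. *)
pose C := \sum_c \sum_j A j c.
have C0 : 0 <= C by apply: sumr_ge0 => c _; apply: sumr_ge0.
pose sim (w : 'rV[R]_p.+2) := \sum_(j < p.+1) 1 * w 0 (lift ord0 j).
pose gap (c : 'I_p.+1) (w : 'rV[R]_p.+2) :=
  \sum_(j < p.+1) A j c * w 0 (lift ord0 j) - w 0 ord0 * w 0 (lift ord0 c).
pose box (i : 'I_p.+2) : set R := (if i == ord0 then `[0, C] else `[0, 1])%classic.
pose K : set 'rV[R]_p.+2 := ([set w : 'rV[R]_p.+2 | forall i, box i (w ord0 i)] `&`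
  ((sim @^-1` [set x | x = 1]) `&`
   \bigcap_(c in [set: 'I_p.+1]) (gap c @^-1` [set x | 0 <= x])))%classic.
have cK : compact K.
  apply: compact_closedI.
    by apply: rV_compact => i; rewrite /box; case: ifP => _; apply: segment_compact.
  apply: closedI.
    by apply: closed_preimage; [exact: continuous_coord_sum | exact: closed_eq].
  apply: closed_bigI => c _; apply: closed_preimage; last exact: closed_ge.
  move=> w; apply: (@cvgB _ _ _ (nbhs w)).
    exact: (@continuous_coord_sum _ (fun j => A j c) (fun j => lift ord0 j)).
  by apply: (@cvgM _ _ (nbhs w)); exact: coord_continuous.
have inK t x : 0 <= t -> nonneg_vec x -> superinvariant t x ->
    exists2 w, K w & w 0 ord0 = t.
  move=> t0 hx ht; have s0 := nonneg_vec_sum_gt0 hx; have [x0 _] := hx.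
  pose s := \sum_c x 0 c.
  pose w : 'rV[R]_p.+2 := \row_i if unlift ord0 i is Some j then x 0 j / s else t.
  have w0 : w 0 ord0 = t by rewrite mxE unlift_none.
  have wS j : w 0 (lift ord0 j) = x 0 j / s by rewrite mxE liftK.
  exists w => //; split; [|split].
  - move=> i; rewrite /box /=; case: (unliftP ord0 i) => [j ->|->].
      rewrite wS (_ : (lift ord0 j == ord0) = false) //= in_itv /=.
      rewrite divr_ge0 ?(ltW s0) //= ler_pdivrMr // mul1r /s (bigD1 j) //= lerDl.
      by rewrite sumr_ge0.
    by rewrite w0 eqxx /= in_itv /= t0 (superinvariant_bound hx).
  - rewrite /= /sim (eq_bigr (fun j => x 0 j / s)) => [|j _]; last by rewrite wS mul1r.
    by rewrite -big_distrl /= divff // gt_eqF.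
  - move=> c _; rewrite /= /gap w0 wS subr_ge0.
    rewrite (eq_bigr (fun j => x 0 j * A j c / s)) => [|j _]; last by rewrite wS; ring.
    rewrite -big_distrl /= mulrA ler_pM2r ?invr_gt0 //.
    by have := ht c; rewrite mxE.
have Kv w : K w -> exists2 y, nonneg_vec y & superinvariant (w 0 ord0) y.
  move=> [hbox [hsim hgap]]; pose y : 'rV[R]_p.+1 := \row_j w 0 (lift ord0 j).
  have hy : nonneg_vec y.
    split=> [c|].
      rewrite mxE; have := hbox (lift ord0 c).
      by rewrite /box (_ : (lift ord0 c == ord0) = false) //= in_itv /= => /andP[].
    apply/eqP => y0; have : sim w = 0.
      rewrite /sim big1 // => j _; have /rowP/(_ j) := y0.
      by rewrite !mxE => ->; rewrite mulr0.
    by rewrite [sim w]hsim => /eqP; rewrite oner_eq0.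
  exists y => // c; have := hgap c I; rewrite /= /gap subr_ge0 [y 0 c]mxE [(y *m A) 0 c]mxE.
  by congr (_ <= _); apply: eq_bigr => j _; rewrite mxE mulrC.
have e0 : nonneg_vec (delta_mx 0 ord0).
  split=> [c|]; first by rewrite mxE ler0n.
  by apply/eqP => /rowP/(_ ord0); rewrite !mxE !eqxx => /eqP; rewrite oner_eq0.
have e0s : superinvariant 0 (delta_mx 0 ord0).
  by move=> c; rewrite mul0r mxE sumr_ge0 // => j _; rewrite mulr_ge0 // e0.1.
have [w0 Kw0 _] := inK _ _ (lexx 0) e0 e0s.
have [] := @compact_EVT_max _ R (fun w : 'rV[R]_p.+2 => w 0 ord0) K.
- by exists w0.
- exact: cK.
- by apply: continuous_subspaceT; exact: coord_continuous.
move=> w; rewrite inE => Kw hmax.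
have [y hy hs] := Kv _ Kw.
exists (w 0 ord0), y; split=> // t x hx ht.
(* A negative [t] lies outside the box, but the maximum is nonnegative since it dominates the first
   coordinate of [w0]. *)
have [t0|t0] := lerP 0 t; last first.
  have := hmax w0; rewrite inE => /(_ Kw0); apply: le_trans.
  have /= := Kw0.1 ord0; rewrite /box eqxx /= in_itv /= => /andP[h _].
  exact: le_trans (ltW t0) h.
have [w' Kw' <-] := inK _ _ t0 hx ht.
by apply: hmax; rewrite inE.
Qed.

(** If every inequality were strict, a slightly larger [S] would still be admissible. *)
Lemma not_all_strict S y :
  (forall t x, nonneg_vec x -> superinvariant t x -> t <= S) ->
  nonneg_vec y -> exists c, ~~ (S * y 0 c < (y *m A) 0 c).
Proof.
move=> hmax hy; apply/existsP; rewrite -negb_forall; apply/negP => /forallP h.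
have [y0 _] := hy.
pose z c := (y *m A) 0 c - S * y 0 c.
have z0 c : 0 < z c by rewrite subr_gt0.
(* The increment [s^-1] must satisfy [s^-1 * y 0 c <= z c] for all [c], so [s] has to exceed each
   ratio [y 0 c / z c]; the summand 1 makes it positive. *)
pose s := \sum_c y 0 c / z c + 1.
have s0 : 0 < s.
  by rewrite ltr_wpDl ?ltr01 // sumr_ge0 // => c _; rewrite divr_ge0 // ltW.
suff : S + s^-1 <= S by rewrite gerDl leNgt invr_gt0 s0.
apply: hmax hy _ => c; rewrite mulrDl -lerBrDl.
rewrite -/(z c) mulrC ler_pdivrMr // mulrC -ler_pdivrMr //.
by rewrite /s (bigD1 c) //= -addrA lerDl addr_ge0 // sumr_ge0 // => i _; rewrite divr_ge0 // ltW.
Qed.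

(* Replacing [y] by [y + y *m A] keeps every strict coordinate strict and adds the
   successors of strict coordinates. *)
Lemma closed_strict_set S y : 0 <= S ->
  nonneg_vec y -> superinvariant S y ->
  exists2 x, nonneg_vec x & superinvariant S x /\
    forall j c, S * x 0 j < (x *m A) 0 j -> 0 < A j c -> S * x 0 c < (x *m A) 0 c.
Proof.
move=> S0.
pose T y := [set c | S * y 0 c < (y *m A) 0 c]%SET.
have [k] := ubnP (p.+1 - #|T y|)%N; elim: k y => // k IHk y hk hy hs.
have [hcl|] := pselect (forall j c, j \in T y -> 0 < A j c -> c \in T y).
  by exists y => //; split=> // j c; have := hcl j c; rewrite !inE.
move=> /existsNP[j /existsNP[c]] /not_implyP[hj] /not_implyP[hjc] /negP hc.
have [y0 yn0] := hy.
pose y' := y + y *m A.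
have y1 i : 0 <= (y *m A) 0 i by rewrite mxE sumr_ge0 // => l _; rewrite mulr_ge0.
(* With [z = y *m A - S *: y], the excess of [y'] is [z + z *m A], a sum of two nonnegative
   vectors. *)
have zE i : (y' *m A) 0 i - S * y' 0 i =
    ((y *m A) 0 i - S * y 0 i) + \sum_l ((y *m A) 0 l - S * y 0 l) * A l i.
  rewrite mulmxDl; set w := y *m A.
  have -> : (w + w *m A) 0 i = w 0 i + \sum_l w 0 l * A l i by rewrite !mxE.
  have -> : y' 0 i = y 0 i + w 0 i by rewrite mxE.
  have -> : \sum_l (w 0 l - S * y 0 l) * A l i = \sum_l w 0 l * A l i - S * w 0 i.
    rewrite [w 0 i]mxE big_distrr /= -sumrB; apply: eq_bigr => l _; ring.
  ring.
have z0 i : 0 <= (y *m A) 0 i - S * y 0 i by rewrite subr_ge0.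
have zA0 i : 0 <= \sum_l ((y *m A) 0 l - S * y 0 l) * A l i.
  by rewrite sumr_ge0 // => l _; rewrite mulr_ge0.
have hy' : nonneg_vec y'.
  split=> [i|]; first by rewrite mxE addr_ge0.
  apply: contraNneq yn0 => e; apply/eqP/rowP => i.
  have /rowP/(_ i) := e; rewrite !mxE => /eqP.
  by rewrite paddr_eq0 // ?sumr_ge0 // => [/andP[/eqP]|l _]; rewrite ?mulr_ge0.
apply: (IHk y') => //.
  suff : (#|T y| < #|T y'|)%N.
    have hT : (#|T y'| <= p.+1)%N by rewrite -[X in (_ <= X)%N]card_ord max_card.
    by move=> hlt; rewrite ltnS in hk; apply: leq_trans hk; apply: ltn_sub2l => //; apply: leq_trans hT.
  apply: proper_card; apply/properP; split.
    apply/fintype.subsetP => i; rewrite !inE -subr_gt0 => hi.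
    by rewrite -subr_gt0 zE ltr_wpDr.
  exists c => //; rewrite !inE -subr_gt0 zE ltr_wpDl //.
  rewrite (bigD1 j) //= ltr_pwDl ?mulr_gt0 ?subr_gt0 //; first by move: hj; rewrite inE.
  by rewrite sumr_ge0 // => l _; rewrite mulr_ge0.
by move=> i; rewrite -subr_ge0 zE addr_ge0.
Qed.

End CollatzWielandt.

(** * The lifting matrix and its Perron vector *)

Section LiftingMatrix.
Variables (R : realType) (p : nat).
Local Notation m := p.+1.
Local Notation A := (lifting_matrix R m).
Implicit Types (j c : 'I_m) (y : 'rV[R]_m).

Lemma lifting_matrix_ge0 j c : 0 <= A j c.
Proof. by rewrite mxE ler0n. Qed.

Lemma binom_ge_gt0 b a : (0 < binom_ge b a)%N = (a <= b)%N.
Proof.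
apply/card_gt0P/idP => [[S]|h].
  by rewrite inE => /leq_trans; apply; rewrite -[X in (_ <= X)%N]card_ord max_card.
by exists [set: 'I_b]%SET; rewrite inE cardsT card_ord.
Qed.

(** Here [2 * j + 1 - c] is 0 or 1, so the binomial is nonzero. *)
Lemma lifting_matrix_up j c : (0 < c)%N -> j = c./2 :> nat -> 0 < A j c.
Proof.
move=> c0 jc; rewrite mxE ltr0n eqn0Ngt c0 /= ifT; last lia.
rewrite bin_gt0; lia.
Qed.

(** Column 0 serves while [2 * j + 1 <= m]. Beyond that, [c = 2 * j - p] makes the entry ['C(m, m)],
    and [c < j] because [j < p]. *)
Lemma lifting_matrix_down j : (j < p)%N ->
  exists2 c, 0 < A j c & (c < j)%N || (c == ord0).
Proof.
move=> jp; have [h|h] := leqP (2 * j + 1) m.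
  by exists ord0; rewrite ?eqxx ?orbT // mxE eqxx ltr0n binom_ge_gt0.
have hc : (2 * j - p < m)%N by lia.
exists (Ordinal hc); last by rewrite /=; apply/orP; left; lia.
rewrite mxE ltr0n /= ifF; last lia.
rewrite ifT; last lia.
rewrite bin_gt0; lia.
Qed.

(** From any index but the last there is a descending path to 0, and from 0 every [c] is reached
    through its successive halves. *)
Lemma lifting_matrix_irreducible (T : pred 'I_m) j :
  (forall i c, T i -> 0 < A i c -> T c) -> T j -> (j < p)%N -> forall c, T c.
Proof.
move=> hT Tj jp.
have T0 : T ord0.
  have [k] := ubnP (j : nat); elim: k j Tj jp => // k IHk j Tj jp hk.
  have [c hc] := lifting_matrix_down jp.
  have Tc := hT _ _ Tj hc.
  by case/orP => [cj|/eqP <- //]; apply: (IHk c) => //; lia.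
move=> c; have [k] := ubnP (c : nat); elim: k c => // k IHk c hk.
have [c0|c0] := posnP (c : nat); first by rewrite (_ : c = ord0) //; apply: val_inj.
have hh : (c./2 < m)%N by have := ltn_ord c; lia.
by apply: (hT (Ordinal hh)); [apply: IHk; rewrite /=; lia | apply: lifting_matrix_up].
Qed.

Lemma lifting_matrix_last c : (0 < p)%N -> A ord_max c = (c == ord_max)%:R.
Proof.
move=> p0; rewrite mxE -val_eqE /=; congr _%:R; have := ltn_ord c.
have [->|c0 cm] := posnP (c : nat).
  rewrite (_ : (0 == p)%N = false) => [_|]; last lia.
  by apply/eqP; rewrite -leqn0 leqNgt binom_ge_gt0; lia.
rewrite ifT; last lia.
have [->|cp] := eqVneq (c : nat) p; last by rewrite bin_small //; lia.
by rewrite (_ : 2 * p + 1 - p = m)%N ?binn //; lia.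
Qed.

Lemma lifting_matrix00 : (0 < p)%N -> 1 < A ord0 ord0.
Proof.
move=> p0; rewrite mxE eqxx ltr1n /binom_ge.
apply: (@leq_trans #|[set [set: 'I_m]; [set ord0]]%SET|); last first.
  apply/subset_leq_card/fintype.subsetP => S.
  by rewrite !inE => /orP[] /eqP ->; rewrite ?cardsT ?card_ord ?cards1 muln0.
rewrite cards2 (_ : (_ != _) = true) //; apply/negP => /eqP h.
by have := cardsT 'I_m; rewrite h cards1 card_ord; lia.
Qed.

Lemma lifting_matrix00_ge1 : 1 <= A ord0 ord0.
Proof. by rewrite mxE eqxx ler1n binom_ge_gt0 muln0. Qed.

(* The matrix is irreducible except that its last index leads nowhere else, so
   the strict coordinates of an optimal [y] can only consist of the last one,
   which is then reset to satisfy its own eigenvector equation. *)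
Lemma perron_vector : exists S y,
  [/\ nonneg_vec y, y *m A = S *: y, 1 <= S, (0 < p)%N -> 1 < S &
      forall t x, nonneg_vec x -> superinvariant A t x -> t <= S].
Proof.
have [S [y1 [hy1 hs1 hmax]]] := collatz_wielandt lifting_matrix_ge0.
(* The unit vector at index 0 is superinvariant for [A ord0 ord0]. *)
have S00 : A ord0 ord0 <= S.
  apply: (hmax _ (delta_mx 0 ord0)).
    split=> [c|]; first by rewrite mxE ler0n.
    by apply/eqP => /rowP/(_ ord0); rewrite !mxE !eqxx => /eqP; rewrite oner_eq0.
  move=> c; rewrite -rowE [row _ _ _ _]mxE [delta_mx _ _ _ _]mxE eqxx /=.
  have [->|_] := eqVneq c ord0; first by rewrite mulr1.
  by rewrite mulr0 lifting_matrix_ge0.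
have S1 : 1 <= S := le_trans lifting_matrix00_ge1 S00.
have S1' : (0 < p)%N -> 1 < S by move=> p0; apply: lt_le_trans (lifting_matrix00 p0) S00.
suff [y hy hyA] : exists2 y, nonneg_vec y & y *m A = S *: y by exists S, y.
have S0 : 0 <= S by apply: le_trans S1.
have [y hy [hs hcl]] := closed_strict_set lifting_matrix_ge0 S0 hy1 hs1.
have [y0 yn0] := hy.
pose T c := S * y 0 c < (y *m A) 0 c.
have Tsmall j : T j -> (j < p)%N -> False.
  move=> Tj jp; have hT := lifting_matrix_irreducible (T := T) hcl Tj jp.
  have [c] := not_all_strict hmax hy.
  by move/negP; apply; apply: hT.
have eq_small c : (c < p)%N -> (y *m A) 0 c = S * y 0 c.
  move=> cp; apply/eqP; rewrite eq_le hs andbT leNgt; apply/negP => h.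
  exact: (Tsmall c).
have [p0|p_gt0] := posnP p.
  exists y => //; apply/rowP => c; rewrite [RHS]mxE.
  apply/eqP; rewrite eq_le hs andbT leNgt; apply/negP => h.
  have [c' /negP] := not_all_strict hmax hy; apply.
  rewrite (_ : c' = c) //; apply: val_inj => /=.
  by have := ltn_ord c; have := ltn_ord c'; lia.
have {}S1' := S1' p_gt0.
have sumE (x : 'rV[R]_m) c :
    (x *m A) 0 c = \sum_(j | j != ord_max) x 0 j * A j c + x 0 ord_max * (c == ord_max)%:R.
  by rewrite mxE (bigD1 ord_max) //= addrC lifting_matrix_last.
(* The solution of the last eigenvector equation: [S * b] is the contribution of the other
   coordinates plus [b], the last diagonal entry being 1. *)
pose b := (\sum_(j | j != ord_max) y 0 j * A j ord_max) / (S - 1).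
pose x : 'rV[R]_m := \row_j if j == ord_max then b else y 0 j.
have xE j : j != ord_max -> x 0 j = y 0 j by move=> hj; rewrite mxE (negbTE hj).
have xm : x 0 ord_max = b by rewrite mxE eqxx.
have b0 : 0 <= b.
  apply: divr_ge0; last by rewrite subr_ge0 ltW.
  by rewrite sumr_ge0 // => j _; rewrite mulr_ge0 ?lifting_matrix_ge0.
have nlt c : c != ord_max -> (c < p)%N.
  by rewrite -val_eqE /=; have := ltn_ord c; lia.
exists x; last first.
  apply/rowP => c; rewrite sumE [RHS]mxE (eq_bigr (fun j => y 0 j * A j c)); last first.
    by move=> j hj; rewrite xE.
  have [->|cm] := eqVneq c ord_max.
    rewrite xm mulr1; have : S - 1 != 0 by rewrite subr_eq0 gt_eqF.
    rewrite /b; set s := \sum_(_ | _) _ => h; field; exact: h.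
  rewrite mulr0 addr0 xE // -eq_small ?nlt // sumE (negbTE cm) mulr0 addr0 //.
split=> [c|]; first by rewrite mxE; case: ifP.
(* If [x] vanished, [y] would be supported on the last index, where superinvariance reads
   [S * y <= y], against [1 < S]. *)
apply/eqP => xe0.
have yj0 j : j != ord_max -> y 0 j = 0.
  by move=> hj; rewrite -xE // xe0 mxE.
have ym0 : 0 < y 0 ord_max.
  rewrite lt_neqAle y0 andbT eq_sym; apply: contraNneq yn0 => h.
  by apply/eqP/rowP => j; rewrite mxE; have [->|/yj0] := eqVneq j ord_max.
have := hs ord_max; rewrite sumE big1 => [|j hj]; last by rewrite yj0 // mul0r.
by rewrite eqxx mulr1 add0r ger_pMl // leNgt S1'.
Qed.

(** Positivity spreads along the positive entries of the matrix, hence reaches index 0 from any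
    index but the last. A vector supported on the last index alone would, for [0 < p], have
    eigenvalue 1. *)
Lemma perron_vector_pos y S : nonneg_vec y -> y *m A = S *: y -> 1 <= S ->
  ((0 < p)%N -> 1 < S) -> 0 < y 0 ord0.
Proof.
move=> [y0 yn0] hyA S1 S1'.
have cl i c : 0 < y 0 i -> 0 < A i c -> 0 < y 0 c.
  move=> hi hA; have : 0 < (y *m A) 0 c.
    rewrite mxE (bigD1 i) //= ltr_pwDl ?mulr_gt0 // sumr_ge0 // => l _.
    by rewrite mulr_ge0 ?lifting_matrix_ge0.
  by rewrite hyA mxE pmulr_rgt0 // (lt_le_trans ltr01).
have [[j jp hj]|hno] := pselect (exists2 j : 'I_m, (j < p)%N & 0 < y 0 j).
  exact: (lifting_matrix_irreducible (T := fun c => 0 < y 0 c) cl hj jp).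
have yj0 j : (j < p)%N -> y 0 j = 0.
  move=> jp; apply/eqP; rewrite eq_le y0 andbT leNgt; apply/negP => h.
  by apply: hno; exists j.
have [p0|p0] := posnP p.
  rewrite lt_neqAle y0 andbT eq_sym; apply: contraNneq yn0 => h.
  apply/eqP/rowP => j; rewrite mxE -h; congr (y _ _); apply: val_inj => /=.
  by have := ltn_ord j; lia.
have jp j : j != ord_max -> (j < p)%N.
  by rewrite -val_eqE /=; have := ltn_ord j; lia.
have : (y *m A) 0 ord_max = y 0 ord_max.
  rewrite mxE (bigD1 ord_max) //= big1 ?addr0 => [|j /jp/yj0 ->]; last by rewrite mul0r.
  by rewrite lifting_matrix_last // eqxx mulr1.
rewrite hyA mxE => /eqP; rewrite -subr_eq0 -{2}[y 0 ord_max]mul1r -mulrBl mulf_eq0.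
rewrite subr_eq0 gt_eqF ?S1' //= => /eqP ym0; case/eqP: yn0; apply/rowP => j.
by rewrite mxE; have [->|/jp/yj0] := eqVneq j ord_max.
Qed.

(** The absolute values of an eigenvector for [t] form a superinvariant vector for the absolute
    value of [t], so the extremal [S] bounds all real eigenvalues while being one itself. *)
Lemma lambda_perron : exists y,
  [/\ forall c, 0 <= y 0 c, 0 < y 0 ord0, y *m A = lambda R m *: y & 1 <= lambda R m].
Proof.
have [S [y [hy hyA S1 S1' hmax]]] := perron_vector.
have hS : eigenvalue A S by apply/eigenvalueP; exists y => //; case: hy.
have ub : ubound [set x : R | eigenvalue A x]%classic S.
  move=> t /= /eigenvalueP[x hx xn0]; apply: le_trans (ler_norm t) _.
  pose ax : 'rV[R]_m := \row_j `|x 0 j|.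
  apply: (hmax _ ax).
    split=> [c|]; first by rewrite mxE.
    apply: contraNneq xn0 => /rowP h; apply/eqP/rowP => j.
    by have := h j; rewrite !mxE => /eqP; rewrite normr_eq0 => /eqP.
  move=> c; rewrite mxE -normrM.
  have -> : t * x 0 c = (x *m A) 0 c by rewrite hx mxE.
  rewrite mxE [leRHS]mxE; apply: le_trans (ler_norm_sum _ _ _) _.
  by apply: ler_sum => j _; rewrite normrM [ax _ _]mxE (ger0_norm (lifting_matrix_ge0 _ _)).
have lamE : lambda R m = S.
  apply/eqP; rewrite eq_le; apply/andP; split.
    by apply: ge_sup => //; exists S.
  by apply: ub_le_sup => //; exists S.
exists y; rewrite lamE; split=> //; first by case: hy.
exact: perron_vector_pos hyA S1 S1'.
Qed.

(** * Growth of the number of survivors *)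

Definition carry_vector (y : 'rV[R]_m) (c : nat) : R := \sum_(j < m | (j <= c)%N) y 0 j.

Lemma binom_ge_succ b a k : (k <= a)%N ->
  #|[set x : {set 'I_b} | a < #|x| + k.+1]%SET|%N =
  (#|[set x : {set 'I_b} | a < #|x| + k]%SET| + 'C(b, a - k))%N.
Proof.
move=> ka.
have eqE (x : {set 'I_b}) : (#|x| == (a - k)%N) = (a == (#|x| + k)%N).
  by rewrite -(eqn_add2r k) subnK // eq_sym.
rewrite -[in 'C(b, _)](card_ord b) -card_draws -cardsUI.
rewrite (_ : (_ :&: _)%SET = finset.set0) ?cards0 ?addn0.
  congr (#|pred_of_set _|); apply/setP => x; rewrite !inE eqE.
  by rewrite addnS ltnS leq_eqVlt orbC.
apply/setP => x; rewrite !inE eqE.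
by case: eqP => [->|_]; rewrite ?ltnn ?andbF.
Qed.

(* Partial row sums of the lifting matrix are the transition counts of the
   greatest carry: from [c], a column of weight [#|x|] leads to a greatest carry
   [>= j] iff [2 * j + 1 <= #|x| + c]. *)
Lemma lifting_matrix_cumulative j (c : nat) : (c < m)%N ->
  \sum_(c' < m | (c' <= c)%N) A j c' = #|[set x : {set 'I_m} | (2 * j < #|x| + c)%N]%SET|%:R.
Proof.
move=> cm.
pose a k := if (k == 0)%N then binom_ge m (2 * j + 1)
            else if (k <= 2 * j + 1)%N then 'C(m, 2 * j + 1 - k) else 0%N.
transitivity (\sum_(k < c.+1) (a k)%:R : R).
  rewrite (big_ord_widen m (fun k => (a k)%:R)) //.
  by apply: eq_bigr => k _; rewrite mxE.
rewrite -natr_sum; congr _%:R.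
elim: c {cm} => [|c IHc].
  rewrite big_ord1 /a eqxx /binom_ge; congr (#|pred_of_set _|).
  by apply/setP => x; rewrite !inE; lia.
rewrite big_ord_recr /= IHc /a /=.
have [h|h] := leqP c.+1 (2 * j + 1).
  rewrite binom_ge_succ; last lia.
  by congr (_ + 'C(_, _))%N; lia.
rewrite addn0; congr (#|pred_of_set _|).
by apply/setP => x; rewrite !inE; lia.
Qed.

(** The partial sum at the next carry collects the [y 0 j] with [2 * j < #|x| + c]. After exchanging
    sums, [lifting_matrix_cumulative] turns the number of such [x] into a partial row sum of the
    matrix. *)
Lemma carry_vector_eigen y (l : R) (c : nat) : y *m A = l *: y -> (c < m)%N ->
  l * carry_vector y c =
  \sum_(x : {set 'I_m}) (0 < #|x| + c)%N%:R * carry_vector y (#|x| + c).-1./2.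
Proof.
move=> hy cm; rewrite /carry_vector big_distrr /=.
rewrite (eq_bigr (fun c' : 'I_m => \sum_j y 0 j * A j c')); last first.
  by move=> c' _; have /rowP/(_ c') := hy; rewrite !mxE => <-.
rewrite exchange_big /=.
rewrite (eq_bigr (fun j : 'I_m => \sum_(x : {set 'I_m}) y 0 j * (2 * j < #|x| + c)%N%:R)).
  rewrite exchange_big; apply: eq_bigr => x _; rewrite big_distrr /=.
  rewrite [RHS]big_mkcond /=; apply: eq_bigr => j _.
  rewrite (_ : (2 * j < #|x| + c)%N = (0 < #|x| + c)%N && (j <= (#|x| + c).-1./2)%N); last lia.
  by case: (0 < _)%N; case: (j <= _)%N; rewrite /= ?mul1r ?mul0r ?mulr1 ?mulr0.
move=> j _; rewrite -big_distrr /= lifting_matrix_cumulative // -big_distrr /=.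
congr (_ * _); rewrite -natr_sum -sum1_card big_mkcond /=; congr _%:R.
by apply: eq_bigr => x _; rewrite inE; case: (_ < _)%N.
Qed.

(** Weight at most [m] and carry at most [m - 1] give a new carry of at most half of [2 * m - 2]. *)
Lemma carry_bound (x : {set 'I_m}) (c : nat) : (c < m)%N -> ((#|x| + c).-1./2 < m)%N.
Proof. by move=> cm; have := max_card (mem x); rewrite card_ord => h; move: h cm; set k := #|_|; lia. Qed.

Section Growth.
Variables (y : 'rV[R]_m) (l : R).
Hypotheses (y_ge0 : forall c, 0 <= y 0 c) (y0_gt0 : 0 < y 0 ord0).
Hypothesis y_eigen : y *m A = l *: y.
Local Notation v := (carry_vector y).

Lemma carry_vector_le (b c : nat) : (b <= c)%N -> v b <= v c.
Proof.
move=> bc; rewrite /carry_vector [leRHS]big_mkcond [leLHS]big_mkcond /=.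
apply: ler_sum => j _; have [jb|_] := leqP j b; first by rewrite (leq_trans jb bc).
by case: ifP.
Qed.

Lemma carry_vector_gt0 (c : nat) : 0 < v c.
Proof.
by rewrite /carry_vector (bigD1 ord0) //= ltr_pwDl // sumr_ge0.
Qed.

(** [survivors] and [l ^+ n * v c] obey the same recursion with nonnegative coefficients, so it
    suffices to compare them at [n = 0], where [v c <= v p]; [survivors_upper] uses [v 0 <= v c]
    instead. *)
Lemma survivors_lower n (c : nat) : (c < m)%N -> l ^+ n * v c <= (survivors m n c)%:R * v p.
Proof.
elim: n c => [|n IHn] c cm; first by rewrite expr0 /= !mul1r; apply: carry_vector_le; rewrite -ltnS.
rewrite exprSr -mulrA (carry_vector_eigen y_eigen cm) /= natr_sum big_distrr big_distrl /=.
apply: ler_sum => x _; rewrite natrM mulrCA -mulrA; apply: ler_wpM2l => //.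
exact/IHn/carry_bound.
Qed.

Lemma survivors_upper n (c : nat) : (c < m)%N -> (survivors m n c)%:R * v 0 <= l ^+ n * v c.
Proof.
elim: n c => [|n IHn] c cm; first by rewrite expr0 /= !mul1r; apply: carry_vector_le.
rewrite exprSr -mulrA (carry_vector_eigen y_eigen cm) /= natr_sum big_distrl [leRHS]big_distrr /=.
apply: ler_sum => x _; rewrite natrM mulrCA -mulrA; apply: ler_wpM2l => //.
exact/IHn/carry_bound.
Qed.

(** At the largest carry [p], the eigenvector equation has one term for each of the [2 ^ m] columns,
    each at most [v p]. *)
Lemma eigen_le_pow2 : l <= 2 ^+ m.
Proof.
rewrite -(ler_pM2r (carry_vector_gt0 p)) (carry_vector_eigen y_eigen) //.
apply: (@le_trans _ _ (\sum_(x : {set 'I_m}) v p)).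
  apply: ler_sum => x _; rewrite -[leRHS]mul1r; apply: ler_pM => //.
  - exact/ltW/carry_vector_gt0.
  - by case: (0 < _)%N.
  by apply: carry_vector_le; have := carry_bound x (ltnSn p).
have card_sets : #|{set 'I_m}| = (2 ^ m)%N.
  by rewrite -cardsT -powersetT card_powerset cardsT card_ord.
by rewrite sumr_const card_sets -[leLHS]mulr_natl natrX.
Qed.
End Growth.
End LiftingMatrix.

(** * Asymptotics of the rate *)

Section Asymptotics.
Variable R : realType.

Lemma powR2_log2 (l : R) m k : 0 < l ->
  (2 ^+ k) `^ (log2 l - m%:R) = (l / 2 ^+ m) ^+ k.
Proof.
move=> l0; rewrite -(powR_mulrn _ (ler0n R 2)) -powRrM mulrC powRrM.
rewrite powR_mulrn ?powR_ge0 //; congr (_ ^+ _).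
have ln2 : ln 2 != 0 :> R by rewrite gt_eqF // ln_gt0 // ltr1n.
rewrite powRB ?powR_mulrn //; last by rewrite pnatr_eq0 implybT.
by congr (_ / _); rewrite /powR pnatr_eq0 /= /log2 divfK // lnK.
Qed.

Lemma powR_antitone (E x y : R) : E <= 0 -> 0 < x -> x <= y -> y `^ E <= x `^ E.
Proof.
move=> E0 x0 xy; rewrite -[E]opprK ![_ `^ (- - E)]powRN.
rewrite lef_pV2 ?posrE ?powR_gt0 //; last exact: lt_le_trans xy.
by apply: ge0_ler_powR; rewrite ?nnegrE ?oppr_ge0 // ltW // (lt_le_trans x0).
Qed.

(** The lower bound frees [s] low bits, using [2 ^ s <= r]; the upper bound frees [s.+1], using
    [r < 2 ^ s.+1], and so keeps one column fewer. Division by [q ^ m] cancels the factor of the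
    free bits. *)
Lemma rate_sandwich (F : finFieldType) m l s n r : (0 < m)%N ->
  #|F| = (2 ^ l)%N -> l = (s + n.+1)%N -> (0 < r)%N -> (2 ^ s <= r < 2 ^ s.+1)%N -> (r < 2 ^ l)%N ->
  (survivors m n.+1 0)%:R / (2 ^+ m) ^+ n.+1
    <= 1 - rate R (lifted_RS F m (2 ^ l - r))
    <= (survivors m n m.-1)%:R / (2 ^+ m) ^+ n.
Proof.
move=> m0 cF el r0 /andP[sr rs] rl.
have char2 : 2%N \in [pchar F] by apply: card_finPcharP cF _.
rewrite (rate_lifted_RS m char2) cF; set b := box_count _ _.
have hq : 0 < (((2 ^ l) ^ m)%N)%:R :> R by rewrite ltr0n !expn_gt0.
have lo : ((2 ^ s) ^ m * survivors m n.+1 0 <= b)%N.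
  by rewrite /b el; apply: bad_exp_lower.
have hi : (b <= (2 ^ s.+1) ^ m * survivors m n m.-1)%N.
  have e : l = (s.+1 + n)%N by rewrite el addSnnS.
  by rewrite /b e; apply: bad_exp_upper => //; rewrite -e.
have e1 k : (2 ^+ m) ^+ k = (((2 ^ k) ^ m)%N)%:R :> R by rewrite !natrX exprAC.
have qE : ((2 ^ l) ^ m = (2 ^ s) ^ m * (2 ^ n.+1) ^ m)%N by rewrite el expnD expnMn.
have qE' : ((2 ^ l) ^ m = (2 ^ s.+1) ^ m * (2 ^ n) ^ m)%N by rewrite el -addSnnS expnD expnMn.
have nz k : (((2 ^ k) ^ m)%N)%:R != 0 :> R.
  by rewrite pnatr_eq0 -lt0n !expn_gt0.
apply/andP; split.
  rewrite ler_pdivlMr // qE e1 [X in _ * X]natrM mulrA mulrAC divfK //.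
  by rewrite -natrM ler_nat mulnC.
rewrite ler_pdivrMr // qE' e1 [X in _ * X]natrM mulrA mulrAC divfK //.
by rewrite -natrM ler_nat mulnC.
Qed.

End Asymptotics.

Theorem theorem1 (R : realType) (m : nat) (hm : (1 <= m)%N) :
  exists c1 c2 : R, [/\ 0 < c1, 0 < c2 &
    exists l0 : nat, forall l : nat, (l0 <= l)%N ->
    forall F : finFieldType, #|F| = (2 ^ l)%N ->
    forall r : nat, (1 <= r < 2 ^ l)%N ->
      c1 * ((2 ^ l)%:R / r%:R) `^ (log2 (lambda R m) - m%:R)
        <= 1 - rate R (lifted_RS F m (2 ^ l - r))
        <= c2 * ((2 ^ l)%:R / r%:R) `^ (log2 (lambda R m) - m%:R)].
Proof.
case: m hm => // p _.
have [y [y_ge0 y0_gt0 hyA lam1]] := lambda_perron R p.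
set lam := lambda R p.+1 in hyA lam1 *.
have lam0 : 0 < lam by apply: lt_le_trans lam1.
pose v := carry_vector y.
have v_gt0 c : 0 < v c := carry_vector_gt0 y_ge0 y0_gt0 c.
pose a := lam / 2 ^+ p.+1.
have p2_gt0 : 0 < 2 ^+ p.+1 :> R by rewrite exprn_gt0.
have a_gt0 : 0 < a by rewrite divr_gt0.
have lam_le := eigen_le_pow2 y_ge0 y0_gt0 hyA.
have E_le0 : log2 lam - p.+1%:R <= 0.
  have ln2 : 0 < ln 2 :> R by rewrite ln_gt0 // ltr1n.
  rewrite subr_le0 /log2 ler_pdivrMr // mulr_natl -lnXn ?ltr0n //.
  by rewrite ler_ln ?posrE.
(* The ratios of [v 0] and [v p] come from the bounds on [survivors]; the extra factor [a] absorbs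
   the step between [n] and [n.+1]. *)
exists (v 0 / v p * a), (v p / v 0 / a); split.
- by rewrite !mulr_gt0 ?invr_gt0.
- by rewrite !divr_gt0.
exists 0%N => l _ F cF r /andP[r0 rl].
pose s := trunc_log 2 r.
have hs : (2 ^ s <= r < 2 ^ s.+1)%N.
  by rewrite trunc_logP // trunc_log_ltn.
have sl : (s < l)%N.
  by case/andP: hs => h _; rewrite -(@ltn_exp2l 2) //; apply: leq_ltn_trans rl.
pose n := (l - s.+1)%N.
have el : l = (s + n.+1)%N by rewrite -addSnnS subnKC.
have /andP[lo hi] := rate_sandwich R (ltn0Sn p) cF el r0 hs rl.
set x := _ / r%:R; set E := _ - _ in E_le0 *.
have rR : 0 < r%:R :> R by rewrite ltr0n.
have x_lo : 2 ^+ n <= x.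
  rewrite /x ler_pdivlMr // -natrX -natrM ler_nat.
  have -> : (2 ^ l = 2 ^ n * 2 ^ s.+1)%N by rewrite -expnD [in LHS]el -addSnnS addnC.
  by rewrite leq_mul2l ltnW ?orbT //; case/andP: hs.
have x_hi : x <= 2 ^+ n.+1.
  rewrite /x ler_pdivrMr // -natrX -natrM ler_nat.
  have -> : (2 ^ l = 2 ^ n.+1 * 2 ^ s)%N by rewrite -expnD [in LHS]el addnC.
  by rewrite leq_mul2l; case/andP: hs => ->; rewrite orbT.
(* The exponent [E] is nonpositive, so the bounds on [x] by powers of two are reversed; the power of
   [2 ^+ n] is [a ^+ n]. *)
have xE_hi : x `^ E <= a ^+ n.
  by rewrite -(powR2_log2 _ _ lam0); apply: powR_antitone => //; rewrite exprn_gt0.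
have xE_lo : a ^+ n.+1 <= x `^ E.
  rewrite -(powR2_log2 _ _ lam0); apply: powR_antitone => //.
  by apply: lt_le_trans x_lo; rewrite exprn_gt0.
have aE k : a ^+ k = lam ^+ k / (2 ^+ p.+1) ^+ k by rewrite /a expr_div_n.
apply/andP; split.
  apply: le_trans lo; apply: (@le_trans _ _ (v 0 / v p * a ^+ n.+1)).
    rewrite -mulrA exprS; apply: ler_wpM2l; first by rewrite divr_ge0 // ltW.
    by apply: ler_wpM2l => //; rewrite ltW.
  rewrite aE mulrA ler_pM2r ?invr_gt0 ?exprn_gt0 //.
  rewrite mulrAC ler_pdivrMr // [leLHS]mulrC.
  exact: (survivors_lower y_ge0 hyA n.+1 (ltn0Sn p)).
apply: le_trans hi _; apply: (@le_trans _ _ (v p / v 0 * a ^+ n)).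
  rewrite aE mulrA ler_pM2r ?invr_gt0 ?exprn_gt0 //.
  rewrite mulrAC ler_pdivlMr // [leRHS]mulrC.
  exact: (survivors_upper y_ge0 hyA n (ltnSn p)).
rewrite -[leRHS]mulrA; apply: ler_wpM2l; first by rewrite divr_ge0 // ltW.
by rewrite mulrC ler_pdivlMr // -exprSr.
Qed.
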